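(* Let $f:(\mathbb{C}^2,0)\to(\mathbb{C},0)$ be a holomorphic function germ, mini-regular in $x$, and let $\gamma$ be a polar arc of $f$. Let $\delta_{top}$ denote the co-slope of the top edge of $\mathcal{NP}(f,\gamma)$. Then the part of $\mathcal{NP}(f,\gamma)$ consisting of all compact edges whose co-slope is $<\delta_{top}$ (with their co-slopes and horizontal lengths) is a topological invariant of $f$, i.e. it depends only on the embedded topological type of $f$ (in the sense explained in the context).
   Context: **Arcs.** $\mathbb{F}$ is the field of convergent fractional power series (Puiseux series) in $y$ over $\mathbb{C}$; $\operatorname{ord}$ is the order in $y$; $\mathbb{F}_1=\{\eta\in\mathbb{F}:\operatorname{ord}\eta\ge1\}$. A germ $f$ with $m=\operatorname{ord}_0f$ is mini-regular in $x$ if its initial form $f_m$ satisfies $f_m(1,0)\ne0$; then $f=u\prod_{i=1}^m(x-\zeta_i(y))$ with $u$ a unit and $\zeta_i\in\mathbb{F}_1$ the Puiseux roots. A polar arc of $f$ is $\gamma\in\mathbb{F}_1$ with $f_x(\gamma(y),y)\equiv0$ and $f(\gamma(y),y)\not\equiv0$. **Newton polygons.** For a (possibly fractional in $Y$) series $G(X,Y)=\sum c_{ij}X^iY^j$, $\mathcal{NP}(G)$ is the boundary of the convex hull of $\{(i+u,j+v):c_{ij}\neq0,\ u,v\ge0\}$. $\mathcal{NP}(f,\gamma)$ is the Newton polygon of $f(X+\gamma(Y),Y)$. The co-slope of a line through $(u,0)$ and $(0,v)$, $u,v>0$ (or of an edge lying on a parallel line) is $v/u$. The horizontal length of an edge is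 the length of its projection to the $X$-axis. The top edge of $\mathcal{NP}(f,\gamma)$ is the compact edge whose left vertex is $(0,h)$, $h=\operatorname{ord}f(\gamma(y),y)$. **Kuo–Lu tree and the meaning of topological invariance.** The Kuo–Lu tree $T(f)$ is the tree recording the Puiseux roots $\zeta_i$ of $f$ and their orders of contact $\operatorname{ord}(\zeta_i-\zeta_j)$: starting from a main trunk labelled $m$, one draws a horizontal bar at height the minimal order of contact, splits the roots into groups within which contacts are larger, each group carried by a trunk rising from the bar, and repeats until each trunk carries a single root (a twig); $\operatorname{ord}(\zeta_i-\zeta_j)$ is the height of the bar where the two twigs separate. It is known (Kuo–Lu) that the orders of contact between the Puiseux roots of $f$ and the polar arcs are determined by $T(f)$: they are read off from an auxiliary tree $M^*(f_x)$ constructed combinatorially out of $T(f)$, whose twigs are in one-to-one correspondence with the polars. A topological equivalence $f=g\circ\phi$, with $\phi$ a homeomorphism of $(\mathbb{C}^2,0)$ and $g$ mini-regular in $x$, induces an isomorphism $T(f)\cong T(g)$ matching the Puiseux roots of $f$ with those of $g$ and preserving all their orders of contact. Through it, the twig of $M^*(f_x)$ carrying $\gamma$ corresponds to a twig of $M^*(g_x)$, i.e. $\gamma$ is matched with a polar arc $\gamma'$ of $g$ whose orders of contact with the matched roots of $g$ equal those of $\gamma$ with the roots of $f$ (any polar of $g$ on that twig may serve as $\gamma'$; $\phi$ itself need not send polar arcs to polar arcs). Topological invariance means: $\delta_{top}$ is preserved and the part of $\mathcal{NP}(g,\gamma')$ consisting of compact edges of co-slope $<\delta_{top}$ coincides with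 that of $\mathcal{NP}(f,\gamma)$. *)

(* Defs.v *)
From HB Require Import structures.
From mathcomp Require Import all_boot all_order all_algebra complex.
From mathcomp Require Import all_classical all_reals all_analysis.
Set Implicit Arguments.
Unset Strict Implicit.
Unset Printing Implicit Defensive.
Import Order.TTheory GRing.Theory Num.Theory numFieldNormedType.Exports.
Local Open Scope classical_set_scope.
Local Open Scope ring_scope.
Local Open Scope complex_scope.
Local Open Scope convex_scope.

Section Germs.
Variable R : realType.

(* C{x, y}: a germ at the origin is given by its Taylor coefficients,
   [f i j] being the coefficient of x^i y^j. *)
Definition germ := nat -> nat -> R[i].

Definition holomorphic_germ (f : germ) : Prop :=
  exists r M : R, 0 < r /\
    forall i j, `|f i j| * r%:C ^+ (i + j) <= M%:C.

(* [R[i]^o], not [R[i]], carries the topology of the complex plane. *)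
Definition germ_val (f : germ) (z : R[i]^o * R[i]^o) : R[i]^o :=
  limn (fun n : nat =>
    (\sum_(i < n) \sum_(j < n) f i j * z.1 ^+ i * z.2 ^+ j : R[i]^o)).

Definition germ_dx (f : germ) : germ := fun i j => f i.+1 j *+ i.+1.

Definition order_at0 (f : germ) (m : nat) : Prop :=
  (forall i j, (i + j < m)%N -> f i j = 0) /\
  (exists i j, (i + j)%N = m /\ f i j != 0).

Definition initial_form (f : germ) (m : nat) (x y : R[i]) : R[i] :=
  \sum_(i < m.+1) f i (m - i)%N * x ^+ i * y ^+ (m - i).

(* [m] is the multiplicity of [f]. *)
Definition mini_regular (f : germ) (m : nat) : Prop :=
  order_at0 f m /\ initial_form f m 1 0 != 0.

Definition homeomorphism_germ
    (phi : R[i]^o * R[i]^o -> R[i]^o * R[i]^o) : Prop :=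
  exists (psi : R[i]^o * R[i]^o -> R[i]^o * R[i]^o)
         (U V : set (R[i]^o * R[i]^o)),
    [/\ open_nbhs (0 : R[i]^o * R[i]^o) U, open_nbhs (0 : R[i]^o * R[i]^o) V
      & phi 0 = 0] /\
    [/\ phi @` U = V, {in U, cancel phi psi},
        {within U, continuous phi} & {within V, continuous psi}].

Definition topological_equivalence (f g : germ)
    (phi : R[i]^o * R[i]^o -> R[i]^o * R[i]^o) : Prop :=
  homeomorphism_germ phi /\
  \forall z \near (0 : R[i]^o * R[i]^o), germ_val f z = germ_val g (phi z).

End Germs.

Section PuiseuxSeries.
Variable R : realType.

(* Fractional power series in y: [a q] is the coefficient of y^q. *)
Definition fracseries := rat -> R[i].

Definition puiseux_series (a : fracseries) : Prop :=
  exists (N : nat) (k0 : int), [/\ (0 < N)%N,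
    forall q, a q != 0 -> exists k : nat, q = (k0 + k%:Z)%:~R / N%:R
  & exists r M : R, 0 < r /\
      forall k : nat,
        `|a ((k0 + k%:Z)%:~R / N%:R)| * r%:C ^+ k <= M%:C].

(* The order in y; it is +oo for the zero series. *)
Definition ord (a : fracseries) : \bar R :=
  ereal_inf [set (ratr q)%:E | q in [set q | a q != 0]].

Definition contact (a b : fracseries) : \bar R := ord (fun q => a q - b q).

(* The set F_1. *)
Definition arc (a : fracseries) : Prop :=
  puiseux_series a /\ (1%:E <= ord a)%E.

(* Series in X and fractional powers of Y: [G i q] is the coefficient of
   X^i Y^q. The sums over infinite sets below are [fsbigop]s, hence equal to 0
   unless finitely many terms are nonzero; this is always the case when the
   exponents of Y have a common denominator and are bounded below, resp. when
   a series of the form c X + a(Y), with [a] of order >= 1, is substituted. *)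
Definition series2 := nat -> rat -> R[i].

Definition series2_of (a : fracseries) : series2 :=
  fun i q => if i == 0%N then a q else 0.

Definition series2_one : series2 := series2_of (fun q => (q == 0)%:R).

Definition series2_X : series2 := fun i q => ((i == 1%N) && (q == 0))%:R.

Definition series2_add (A B : series2) : series2 := fun i q => A i q + B i q.

Definition series2_sub (A B : series2) : series2 := fun i q => A i q - B i q.

Definition series2_mul (A B : series2) : series2 := fun i q =>
  \sum_(k < i.+1) \sum_(p \in [set: rat]) A k p * B (i - k)%N (q - p).

Definition series2_exp (A : series2) (k : nat) : series2 :=
  iter k (series2_mul A) series2_one.

(* f(A(X, Y), Y) *)
Definition subst_x (f : germ R) (A : series2) : series2 := fun i q =>
  \sum_(kj \in [set: nat * nat])
     f kj.1 kj.2 * series2_exp A kj.1 i (q - kj.2%:R).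

(* f(a(y), y) *)
Definition along (f : germ R) (a : fracseries) : fracseries :=
  subst_x f (series2_of a) 0%N.

(* f(X + a(Y), Y) *)
Definition shift_x (f : germ R) (a : fracseries) : series2 :=
  subst_x f (series2_add series2_X (series2_of a)).

(* f = u (x - zeta_1) ... (x - zeta_m), with u a unit of C{x, y}. *)
Definition puiseux_roots (f : germ R) (m : nat) (zeta : 'I_m -> fracseries)
    : Prop :=
  (forall i, arc (zeta i)) /\
  exists u : germ R, [/\ holomorphic_germ u, u 0%N 0%N != 0 &
    subst_x f series2_X =
    series2_mul (subst_x u series2_X)
      (\big[series2_mul/series2_one]_(i < m)
         series2_sub series2_X (series2_of (zeta i)))].

Definition polar_arc (f : germ R) (gamma : fracseries) : Prop :=
  [/\ arc gamma, forall q, along (germ_dx f) gamma q = 0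
    & exists q, along f gamma q != 0].

(* An isomorphism of Kuo-Lu trees is given by what it does on the twigs, i.e.
   on the Puiseux roots: the height of the bar where two twigs separate is
   their order of contact. *)
Definition kuo_lu_isomorphism (m n : nat) (zeta : 'I_m -> fracseries)
    (xi : 'I_n -> fracseries) (sigma : 'I_m -> 'I_n) : Prop :=
  bijective sigma /\
  forall i j, contact (xi (sigma i)) (xi (sigma j)) =
              contact (zeta i) (zeta j).

(* The polars [gamma] and [gamma'] lie on twigs which correspond to each other
   through [sigma]. *)
Definition matched_polars (m n : nat) (zeta : 'I_m -> fracseries)
    (xi : 'I_n -> fracseries) (sigma : 'I_m -> 'I_n)
    (gamma gamma' : fracseries) : Prop :=
  forall i, contact gamma' (xi (sigma i)) = contact gamma (zeta i).

End PuiseuxSeries.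

Section NewtonPolygons.
Variable R : realType.

Definition convex_hull (A : set (R * R)) : set (R * R) :=
  [set p | forall K : set (R * R),
     convex_set (K : set (convex_lmodType (R * R)%type)) ->
     A `<=` K -> K p].

Definition newton_region (G : series2 R) : set (R * R) :=
  convex_hull [set p | exists i q (u v : R),
    [/\ G i q != 0, 0 <= u, 0 <= v & p = (i%:R + u, ratr q + v)]].

Definition newton_polygon (G : series2 R) : set (R * R) :=
  closure (newton_region G) `\` interior (newton_region G).

Definition segment (p q : R * R) : set (R * R) :=
  [set ((p : convex_lmodType (R * R)%type) <| t |> q : R * R)
     | t in [set: {i01 R}]].

(* An edge is given by its left and right vertices. *)
Definition edge : Type := ((R * R) * (R * R))%type.

Definition horizontal_length (e : edge) : R := e.2.1 - e.1.1.

Definition coslope (e : edge) : R := (e.1.2 - e.2.2) / horizontal_length e.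

(* The lines parallel to [e] are the level sets of this function. *)
Definition level (e : edge) (z : R * R) : R := z.2 + coslope e * z.1.

(* Edges are cut out by supporting lines. A compact edge is never vertical,
   as a vertical line cuts the polygon along a half-line. *)
Definition compact_edge (N : set (R * R)) (e : edge) : Prop :=
  [/\ 0 < horizontal_length e,
      forall z, N z -> level e e.1 <= level e z
    & N `&` [set z | level e z = level e e.1] = segment e.1 e.2].

(* NP(f, gamma) *)
Definition arc_polygon (f : germ R) (gamma : fracseries R) : set (R * R) :=
  newton_polygon (shift_x f gamma).

Definition top_edge (f : germ R) (gamma : fracseries R) (e : edge) : Prop :=
  [/\ compact_edge (arc_polygon f gamma) e, e.1.1 = 0
    & (e.1.2)%:E = ord (along f gamma)].

Definition top_coslope (f : germ R) (gamma : fracseries R) (delta : R) : Prop :=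
  exists e, top_edge f gamma e /\ coslope e = delta.

(* The part of NP(f, gamma) made of the compact edges of co-slope < delta;
   the edges determine their co-slopes and horizontal lengths. *)
Definition edges_below (f : germ R) (gamma : fracseries R) (delta : R)
    : set edge :=
  [set e | compact_edge (arc_polygon f gamma) e /\ coslope e < delta].

End NewtonPolygons.

(* Main.v *)
(* Writing f = u prod_i (x - zeta_i) and substituting x = X + gamma, NP(f, gamma)
   is the Newton polygon of prod_i (X + (gamma - zeta_i)), which is the
   Minkowski sum of the polygons of the X + Y^(c_i), where c_i is the order of
   contact of gamma with zeta_i. Hence the whole polygon, and not only its part
   below the top edge, is determined by the c_i. Its support function is
   s |-> sum_i min(s, c_i), and its top edge has co-slope max_i c_i. *)
Require Import Defs.
From HB Require Import structures.
From mathcomp Require Import all_boot all_order all_algebra complex.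
From mathcomp Require Import all_classical all_reals all_analysis.
From mathcomp Require Import ring lra.
Set Implicit Arguments.
Unset Strict Implicit.
Unset Printing Implicit Defensive.
Import Order.TTheory GRing.Theory Num.Theory numFieldNormedType.Exports.
Local Open Scope classical_set_scope.
Local Open Scope ring_scope.
Local Open Scope complex_scope.
Local Open Scope convex_scope.

(** The substitution x = X + gamma is carried out on polynomials in X and T = Y^(1/N), for N a
    common denominator of gamma and the roots, where composition is a ring morphism. With X of
    weight N and T of weight 1, substituting a series of order at least 1 never lowers weights, so
    truncations below weight D give the result below weight D. The Minkowski sum needs terms of the
    product that survive cancellation. They are sought only at co-slopes s different from every c_i:
    each factor then has a single term of least weight, hence so does the product, with a nonzero
    coefficient. Only finitely many co-slopes are excluded, and the neighbours of an excluded one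
    see both ends of the edge of that co-slope, so these vertices generate the polygon. The c_i are
    finite because f(gamma(y), y) is not identically zero. *)

(** * Sums over infinite index sets *)

(** Covering the support by a finite type rules out the default value 0 of an [fsbigop] with
    infinite support; this is how such sums are evaluated below. *)
Lemma fsbig_inj (V : nmodType) (I : finType) (T : choiceType) (h : I -> T)
    (F : T -> V) :
  injective h -> (forall t, F t != 0 -> exists i, t = h i) ->
  \sum_(t \in [set: T]) F t = \sum_i F (h i).
Proof.
move=> hinj hF; rewrite (fsbigE [seq h i | i <- enum I]) //=.
- rewrite -big_enum big_map /=; apply: eq_bigl => i.
  by rewrite in_setT.
- by rewrite map_inj_uniq ?enum_uniq.
- move=> t _ tnin; apply/eqP; apply: contraNT tnin => /hF [i ->].
  by rewrite map_f ?mem_enum.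
Qed.

Lemma fsbig_neq0 (V : nmodType) (T : choiceType) (F : T -> V) :
  \sum_(t \in [set: T]) F t != 0 -> exists t, F t != 0.
Proof.
apply: contra_neqP => /forallNP hF; apply: fsbig1 => t _.
by apply/eqP/negPn/negP/hF.
Qed.

(** * Supports of fractional series *)

Section Supports.
Context {R : realType}.
Implicit Types (A B : series2 R) (a : fracseries R) (P : nat -> rat -> Prop).

Definition supported A P := forall i q, A i q != 0 -> P i q.

Lemma series2_mul_neq0 A B i q : series2_mul A B i q != 0 ->
  exists k p, [/\ (k <= i)%N, A k p != 0 & B (i - k)%N (q - p) != 0].
Proof.
move=> h; have [/= k _ hk] : exists2 k : 'I_i.+1, true &
    \sum_(p \in [set: rat]) A k p * B (i - k)%N (q - p) != 0.
  apply: contraPP h => hn; apply/negP; rewrite negbK; apply/eqP.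
  apply: big1 => k _; apply/eqP; apply/negPn/negP => hk.
  by apply: hn; exists k.
have [p hp] := fsbig_neq0 hk.
exists k, p; move: hp; rewrite mulf_eq0 negb_or => /andP[-> ->].
by rewrite -ltnS ltn_ord.
Qed.

(** [P] plays the role of an additive semigroup of exponents, possibly larger than the support. *)
Lemma supported_mul P A B :
  (forall i j p q, P i p -> P j q -> P (i + j)%N (p + q)) ->
  supported A P -> supported B P -> supported (series2_mul A B) P.
Proof.
move=> PD hA hB i q /series2_mul_neq0[k [p [ki /hA h1 /hB h2]]].
by have := PD _ _ _ _ h1 h2; rewrite subnKC // addrC subrK.
Qed.

Lemma supported_one P : P 0%N 0 -> supported (@series2_one R) P.
Proof.
move=> P0 i q; rewrite /series2_one /series2_of.
by case: i => [|i] /=; [case: (q =P 0) => [->|] //=|]; rewrite eqxx.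
Qed.

Lemma supported_big P m (F : 'I_m -> series2 R) :
  (forall i j p q, P i p -> P j q -> P (i + j)%N (p + q)) -> P 0%N 0 ->
  (forall i, supported (F i) P) ->
  supported (\big[@series2_mul R/@series2_one R]_(i < m) F i) P.
Proof.
move=> PD P0 hF; elim/big_ind: _ => //; first exact: supported_one.
by move=> A B; apply: supported_mul.
Qed.

Lemma supported_exp P A k :
  (forall i j p q, P i p -> P j q -> P (i + j)%N (p + q)) -> P 0%N 0 ->
  supported A P -> supported (series2_exp A k) P.
Proof.
move=> PD P0 hA; elim: k => [|k IH]; first exact: supported_one.
exact: supported_mul.
Qed.

Lemma subst_x_neq0 (f : germ R) A i q : subst_x f A i q != 0 ->
  exists k j, f k j != 0 /\ series2_exp A k i (q - j%:R) != 0.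
Proof.
move=> /fsbig_neq0[[k j]] /=.
by rewrite mulf_eq0 negb_or => /andP[h1 h2]; exists k, j.
Qed.

Definition lattice N : nat -> rat -> Prop :=
  fun _ q => exists k : nat, q = k%:R / N%:R.

Definition order_ge1 : nat -> rat -> Prop := fun i q => 1 <= i%:R + q.

Lemma latticeD N i j p q :
  lattice N i p -> lattice N j q -> lattice N (i + j)%N (p + q).
Proof.
by move=> [k ->] [l ->]; exists (k + l)%N; rewrite natrD mulrDl.
Qed.

Lemma lattice0 N : lattice N 0%N 0.
Proof. by exists 0%N; rewrite mul0r. Qed.

(** Total orders add up in a product. This makes substitution finite: a given exponent receives
    contributions from finitely many powers of [A] only. *)
Lemma series2_exp_order A k : supported A order_ge1 ->
  supported (series2_exp A k) (fun i q => k%:R <= i%:R + q).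
Proof.
move=> hA; elim: k => [|k IH]; first by apply: supported_one; rewrite addr0.
move=> i q /series2_mul_neq0[j [p [ji /hA h1 /IH]]].
rewrite natrB // => h2.
have := lerD h1 h2; rewrite (natrD _ 1 k) addrACA; congr (_ <= _ + _).
  by rewrite addrC subrK.
by rewrite addrC subrK.
Qed.

End Supports.
Arguments lattice : clear implicits.

(** * Truncation to polynomials in X and T *)

Section Truncation.
Context {R : realType} (N : nat) (N_gt0 : (0 < N)%N).
Implicit Types (A B : series2 R) (P Q : {poly {poly R[i]}}).

(* X has weight N and T = Y^(1/N) has weight 1; P represents A up to terms
   of weight at least D. *)
Definition approx D P A :=
  forall i k, (N * i + k < D)%N -> P`_i`_k = A i (k%:R / N%:R).

Let N0 : (N%:R : rat) != 0. Proof. by rewrite pnatr_eq0 -lt0n. Qed.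

Lemma lattice_inj (k l : nat) : k%:R / N%:R = l%:R / N%:R :> rat -> k = l.
Proof. by move/(mulIf (invr_neq0 N0))/eqP; rewrite eqr_nat => /eqP. Qed.

(** Weights are nonnegative and add up, so a coefficient of weight below [D] in a product only
    involves such coefficients of the factors. The lattice hypotheses reduce the convolution over
    the rationals to ['I_k.+1]. *)
Lemma approx_mul D P Q A B :
  supported A (lattice N) -> supported B (lattice N) ->
  approx D P A -> approx D Q B -> approx D (P * Q) (series2_mul A B).
Proof.
move=> lA lB hP hQ i k ikD.
rewrite coefM coef_sum /series2_mul; apply: eq_bigr => j _.
rewrite coefM (@fsbig_inj _ 'I_k.+1 _ (fun l => l%:R / N%:R)).
- apply: eq_bigr => l _; have := ltn_ord j; have := ltn_ord l.
  rewrite !ltnS => lk ji; rewrite -mulrBl -natrB // hP ?hQ //.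
    by apply: leq_ltn_trans ikD; rewrite leq_add ?leq_mul ?leq_subr.
  by apply: leq_ltn_trans ikD; rewrite leq_add ?leq_mul.
- by move=> l1 l2 /lattice_inj/val_inj.
- move=> t; rewrite mulf_eq0 negb_or => /andP[/lA[l ->] /lB[l' e]].
  have kE : k = (l + l')%N.
    by apply: lattice_inj; rewrite natrD mulrDl -e addrC subrK.
  have lk : (l < k.+1)%N by rewrite ltnS kE leq_addr.
  by exists (Ordinal lk).
Qed.

Lemma approx_one D : approx D 1 (@series2_one R).
Proof.
move=> i k _; rewrite /series2_one /series2_of coef1.
case: i => [|i] /=; last by rewrite coef0.
by rewrite coef1 mulf_eq0 invr_eq0 (negbTE N0) orbF pnatr_eq0.
Qed.

Lemma approx_exp D P A k : supported A (lattice N) ->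
  approx D P A -> approx D (P ^+ k) (series2_exp A k).
Proof.
move=> lA hP; elim: k => [|k IH]; first by rewrite expr0; apply: approx_one.
rewrite exprS; apply: approx_mul => //.
by apply: supported_exp => //; [apply: latticeD | apply: lattice0].
Qed.

Lemma approx_big D m (F : 'I_m -> series2 R) (G : 'I_m -> {poly {poly R[i]}}) :
  (forall i, supported (F i) (lattice N)) -> (forall i, approx D (G i) (F i)) ->
  approx D (\prod_(i < m) G i) (\big[@series2_mul R/@series2_one R]_(i < m) F i).
Proof.
move=> lF hG.
suff [] : supported (\big[@series2_mul R/@series2_one R]_(i < m) F i) (lattice N)
  /\ approx D (\prod_(i < m) G i)
       (\big[@series2_mul R/@series2_one R]_(i < m) F i) by [].
elim/big_rec2: _ => [|i P A _ [lA hP]].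
  by split; [apply: supported_one; apply: lattice0 | apply: approx_one].
by split; [apply: supported_mul => //; apply: latticeD | apply: approx_mul].
Qed.

(** The variable y is T^N, whence the exponent [N * j]. *)
Definition germ_poly (f : germ R) D : {poly {poly R[i]}} :=
  \sum_(k < D) \sum_(j < D) (f k j *: 'X^(N * j)) *: 'X^k.

Definition fracseries_poly (a : fracseries R) D : {poly R[i]} :=
  \poly_(k < D) a (k%:R / N%:R).

Lemma germ_poly_comp f D P : germ_poly f D \Po P =
  \sum_(k < D) \sum_(j < D) (f k j *: 'X^(N * j)) *: P ^+ k.
Proof.
rewrite linear_sum /=; apply: eq_bigr => k _.
rewrite linear_sum /=; apply: eq_bigr => j _.
by rewrite comp_polyZ comp_Xn_poly.
Qed.

(** As [A] has order at least 1, A^k Y^j only has terms of weight at least N (k + j); hence below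
    weight [D] the indices k, j < [D] suffice. *)
Lemma approx_subst f D P A :
  supported A (lattice N) -> supported A order_ge1 ->
  approx D P A -> approx D (germ_poly f D \Po P) (subst_x f A).
Proof.
move=> lA oA hP i k ikD; rewrite germ_poly_comp !coef_sum.
rewrite /subst_x (@fsbig_inj _ ('I_D * 'I_D)%type _
  (fun kj => (kj.1 : nat, kj.2 : nat))) /=.
- rewrite -(pair_bigA _ (fun k0 j : 'I_D =>
    f k0 j * series2_exp A k0 i (k%:R / N%:R - j%:R))) /=.
  apply: eq_bigr => l _; rewrite !coef_sum; apply: eq_bigr => j _.
  rewrite coefZ -scalerAl coefZ coefXnM; congr (_ * _).
  have lE : supported (series2_exp A l) (lattice N).
    by apply: supported_exp => //; [apply: latticeD | apply: lattice0].
  have jE : j%:R = (N * j)%:R / N%:R :> rat by rewrite natrM mulrC mulKf.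
  case: ltnP => [kNj|Njk].
    (* The exponent of Y left for the power of [A] is negative here, so both coefficients vanish. *)
    apply/esym/eqP; apply: contraTT kNj => /lE [k' e]; rewrite -leqNgt.
    suff -> : k = (k' + N * j)%N by rewrite leq_addl.
    by apply: lattice_inj; rewrite natrD mulrDl -e -jE subrK.
  rewrite jE -mulrBl -natrB // (approx_exp l lA hP) //.
  by apply: leq_ltn_trans ikD; rewrite leq_add2l leq_subr.
- by move=> [a b] [c d] /= [/val_inj-> /val_inj->].
- move=> [l j] /=; rewrite mulf_eq0 negb_or => /andP[_ h].
  have lE : supported (series2_exp A l) (lattice N).
    by apply: supported_exp => //; [apply: latticeD | apply: lattice0].
  have jE : j%:R = (N * j)%:R / N%:R :> rat by rewrite natrM mulrC mulKf.
  have [k' e] := lE _ _ h.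
  have {lE} kE : k = (k' + N * j)%N.
    by apply: lattice_inj; rewrite natrD mulrDl -e -jE subrK.
  have := series2_exp_order oA h; rewrite e.
  rewrite -(ler_pM2r (x := N%:R)) ?ltr0n // mulrDl divfK // -!natrM -natrD.
  rewrite ler_nat => lN.
  have lD : (l < D)%N.
    apply: leq_ltn_trans ikD; apply: (@leq_trans (l * N)); first exact: leq_pmulr.
    by apply: (leq_trans lN); rewrite mulnC leq_add2l kE leq_addr.
  have jD : (j < D)%N.
    apply: leq_ltn_trans ikD; apply: (@leq_trans (N * j)); first exact: leq_pmull.
    by rewrite kE addnA leq_addl.
  by exists (Ordinal lD, Ordinal jD).
Qed.

End Truncation.

(** * Transport of the root factorization to X + gamma *)

Section Factorization.
Context {R : realType} (N : nat) (N_gt0 : (0 < N)%N).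
Implicit Types (A B : series2 R) (P Q : {poly {poly R[i]}}).

Lemma approx_inj A B :
  supported A (lattice N) -> supported B (lattice N) ->
  (forall D, exists2 P, approx N D P A & approx N D P B) -> A = B.
Proof.
move=> lA lB h.
have AB k i : A i (k%:R / N%:R) = B i (k%:R / N%:R).
  have [P hA hB] := h (N * i + k).+1.
  by rewrite -hA // -hB.
apply/funext => i; apply/funext => q.
have [[k ->]|nq] := pselect (lattice N i q); first exact: AB.
have -> : A i q = 0 by apply/eqP/negPn/negP => /lA.
by apply/esym/eqP/negPn/negP => /lB.
Qed.

Lemma approx_congr D P Q A :
  (forall i k, (N * i + k < D)%N -> P`_i`_k = Q`_i`_k) ->
  approx N D P A -> approx N D Q A.
Proof. by move=> h hP i k ikD; rewrite -h // hP. Qed.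

(** If X^j T^l contributes to X^i T^k after the substitution, the order of A^j gives N j <= N i + k
    - l, so its weight was already at most N i + k. *)
Lemma comp_poly_low0 D P Q A :
  supported A (lattice N) -> supported A order_ge1 -> approx N D Q A ->
  (forall i k, (N * i + k < D)%N -> P`_i`_k = 0) ->
  forall i k, (N * i + k < D)%N -> (P \Po Q)`_i`_k = 0.
Proof.
move=> lA oA hQ hP i k ikD; rewrite comp_polyE !coef_sum big1 // => j _.
rewrite coefZ coefM big1 // => l _.
have lk : (l <= k)%N by rewrite -ltnS ltn_ord.
apply/eqP; rewrite mulf_eq0; apply/orP.
have [|QN0] := eqVneq ((Q ^+ j)`_i)`_(k - l) 0; first by right.
left; apply/eqP; apply: hP; apply: leq_ltn_trans (ikD).
move: QN0; rewrite (approx_exp N_gt0 j lA hQ); last first.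
  by apply: leq_ltn_trans ikD; rewrite leq_add2l leq_subr.
move/(series2_exp_order oA).
rewrite -(ler_pM2r (x := N%:R)) ?ltr0n // mulrDl divfK ?pnatr_eq0 -?lt0n //.
by rewrite -!natrM -natrD ler_nat mulnC (mulnC i) -(leq_add2r l) -addnA subnK.
Qed.

Lemma approxX D : approx N D 'X (@series2_X R).
Proof.
move=> i k _; rewrite /series2_X coefX.
have -> : ((k%:R / N%:R : rat) == 0) = (k == 0)%N.
  by rewrite mulf_eq0 invr_eq0 !pnatr_eq0 (gtn_eqF N_gt0) orbF.
by case: (i == 1)%N; rewrite /= ?coef1 ?coef0 //; case: k.
Qed.

Lemma approx_of D (a : fracseries R) :
  approx N D (fracseries_poly N a D)%:P (series2_of a).
Proof.
move=> i k ikD; rewrite coefC /series2_of.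
case: (i == 0)%N; last by rewrite coef0.
by rewrite coef_poly (leq_ltn_trans _ ikD) // leq_addl.
Qed.

Lemma approx_add D P Q A B :
  approx N D P A -> approx N D Q B -> approx N D (P + Q) (series2_add A B).
Proof. by move=> hP hQ i k ikD; rewrite !coefD hP // hQ. Qed.

Lemma approx_sub D P Q A B :
  approx N D P A -> approx N D Q B -> approx N D (P - Q) (series2_sub A B).
Proof. by move=> hP hQ i k ikD; rewrite !coefB hP // hQ. Qed.

Lemma supported_add (P : nat -> rat -> Prop) A B :
  supported A P -> supported B P -> supported (series2_add A B) P.
Proof.
move=> hA hB i q; rewrite /series2_add.
have [->|/hA //] := eqVneq (A i q) 0; rewrite add0r; exact: hB.
Qed.

Lemma supported_sub (P : nat -> rat -> Prop) A B :
  supported A P -> supported B P -> supported (series2_sub A B) P.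
Proof.
move=> hA hB i q; rewrite /series2_sub.
have [->|/hA //] := eqVneq (A i q) 0; rewrite sub0r oppr_eq0; exact: hB.
Qed.

Lemma supported_X (P : nat -> rat -> Prop) : P 1%N 0 -> supported (@series2_X R) P.
Proof.
move=> P1 i q; rewrite /series2_X.
by have [->|_] := eqVneq i 1%N; have [->|_] := eqVneq q 0; rewrite ?eqxx.
Qed.

Lemma lattice_subst_x (f : germ R) A :
  supported A (lattice N) -> supported (subst_x f A) (lattice N).
Proof.
move=> lA i q /subst_x_neq0[k [j [_]]].
have lE : supported (series2_exp A k) (lattice N).
  by apply: supported_exp => //; [apply: latticeD | apply: lattice0].
move=> /lE[l e]; exists (l + N * j)%N.
rewrite natrD mulrDl -e natrM mulrAC divff ?mul1r ?subrK //.
by rewrite pnatr_eq0 -lt0n.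
Qed.

Lemma series2_of_sub (a b : fracseries R) :
  series2_of (fun q => a q - b q) = series2_sub (series2_of a) (series2_of b).
Proof.
apply/funext => i; apply/funext => q; rewrite /series2_sub /series2_of.
by case: ifP => //; rewrite subr0.
Qed.

Lemma shift_x_factorization (f u : germ R) m (zeta : 'I_m -> fracseries R)
    (a : fracseries R) :
  supported (series2_of a) (lattice N) -> supported (series2_of a) order_ge1 ->
  (forall i, supported (series2_of (zeta i)) (lattice N)) ->
  subst_x f (@series2_X R) = series2_mul (subst_x u (@series2_X R))
    (\big[@series2_mul R/@series2_one R]_(i < m)
       series2_sub (@series2_X R) (series2_of (zeta i))) ->
  shift_x f a = series2_mul (shift_x u a)
    (\big[@series2_mul R/@series2_one R]_(i < m)
       series2_add (@series2_X R) (series2_of (fun q => a q - zeta i q))).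
Proof.
move=> la oa lz fE.
have lX : supported (@series2_X R) (lattice N) by apply: supported_X; exact: lattice0.
have oX : supported (@series2_X R) order_ge1.
  by apply: supported_X; rewrite /order_ge1 addr0.
have lXa := supported_add lX la; have oXa := supported_add oX oa.
have lbig (F : 'I_m -> series2 R) : (forall i, supported (F i) (lattice N)) ->
    supported (\big[@series2_mul R/@series2_one R]_(i < m) F i) (lattice N).
  by move=> lF; apply: supported_big => //; [apply: latticeD | apply: lattice0].
have lfac i : supported (series2_add (@series2_X R)
    (series2_of (fun q => a q - zeta i q))) (lattice N).
  by rewrite series2_of_sub; apply: supported_add => //; apply: supported_sub.
apply: approx_inj.
- exact: lattice_subst_x.
- by apply: supported_mul; [apply: latticeD | apply: lattice_subst_x | apply: lbig].
move=> D.
pose L := 'X + (fracseries_poly N a D)%:P : {poly {poly R[i]}}.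
have hL : approx N D L (series2_add (@series2_X R) (series2_of a)).
  by apply: approx_add; [apply: approxX | apply: approx_of].
pose z i := (fracseries_poly N (zeta i) D)%:P : {poly {poly R[i]}}.
pose Q := germ_poly N u D * \prod_(i < m) ('X - z i).
have low i k : (N * i + k < D)%N -> (germ_poly N f D - Q)`_i`_k = 0.
  move=> ikD; apply/eqP; rewrite !coefB subr_eq0; apply/eqP.
  have X_subst g : approx N D (germ_poly N g D) (subst_x g (@series2_X R)).
    rewrite -[germ_poly N g D]comp_polyXr.
    by apply: approx_subst => //; apply: approxX.
  rewrite X_subst // fE; apply/esym; move: i k ikD.
  apply: (@approx_mul R N N_gt0) => //.
  - exact: lattice_subst_x.
  - by apply: lbig => i; apply: supported_sub.
  - apply: approx_big => // i; first by apply: supported_sub.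
    by apply: approx_sub; [apply: approxX | apply: approx_of].
exists (germ_poly N f D \Po L); first exact: approx_subst.
(* The truncation of f agrees with the factored polynomial [Q] only below weight [D]; the error
   keeps weight at least [D] when [L] is substituted. *)
apply: (@approx_congr D (Q \Po L)).
  move=> i k ikD; apply/esym/eqP; rewrite -subr_eq0 -!coefB -comp_polyB.
  by apply/eqP/(comp_poly_low0 lXa oXa hL low ikD).
have -> : Q \Po L = (germ_poly N u D \Po L) * \prod_(i < m) (('X - z i) \Po L).
  rewrite /Q comp_polyM; congr (_ * _).
  exact: (big_morph (comp_poly L) (fun p q => comp_polyM p q L)
    (comp_polyC 1 L)).
apply: approx_mul => //; first exact: lattice_subst_x.
- exact: lbig.
- exact: approx_subst.
apply: approx_big => // i; rewrite comp_polyB comp_polyX comp_polyC -addrA.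
apply: approx_add; first exact: approxX.
by rewrite series2_of_sub; apply: approx_sub; apply: approx_of.
Qed.

End Factorization.

(** * Common denominators of arcs *)

Lemma arc_order_ge1 (R : realType) (a : fracseries R) (q : rat) :
  Defs.arc a -> a q != 0 -> 1 <= q.
Proof.
move=> [_ oa] aq.
have : (1%:E <= (ratr q : R)%:E)%E.
  by apply: (le_trans oa); apply: ereal_inf_lbound; exists q.
by rewrite lee_fin -(rmorph1 (@ratr R)) ler_rat.
Qed.

(** Stated for all multiples of the denominator, so that finitely many arcs can share one. *)
Lemma arc_lattice (R : realType) (a : fracseries R) : Defs.arc a ->
  exists2 N, (0 < N)%N & forall M, (0 < M)%N -> (N %| M)%N ->
    supported (series2_of a) (lattice M).
Proof.
move=> aa; have [[N [k0 [N0 hN _]]] _] := aa; exists N => // M M0 /dvdnP[d dE].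
move=> i q; rewrite /series2_of; case: ifP => _; last by rewrite eqxx.
move=> aq; have := arc_order_ge1 aa aq; have [k ->] := hN _ aq.
have N0' : (N%:R : rat) != 0 by rewrite pnatr_eq0 -lt0n.
rewrite ler_pdivlMr ?ltr0n // mul1r => h.
(* [k0] may be negative; order at least 1 makes the numerators that occur natural numbers. *)
have : (0 : rat) <= (k0 + k%:Z)%:~R by apply: le_trans h.
rewrite ler0z; case: (k0 + k%:Z) => // n _.
exists (n * d)%N; rewrite dE !natrM.
have d0 : (d%:R : rat) != 0.
  by rewrite pnatr_eq0; apply: contraTneq M0 => d0; rewrite dE d0.
by rewrite invfM mulrA mulfK.
Qed.

Lemma puiseux_roots_factorization (R : realType) (f : germ R) m
    (zeta : 'I_m -> fracseries R) (gamma : fracseries R) :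
  puiseux_roots f zeta -> Defs.arc gamma ->
  exists u : germ R, u 0%N 0%N != 0 /\
  shift_x f gamma = series2_mul (shift_x u gamma)
    (\big[@series2_mul R/@series2_one R]_(i < m)
       series2_add (@series2_X R) (series2_of (fun q => gamma q - zeta i q))).
Proof.
move=> [az [u [_ u0 fE]]] ag; exists u; split => //.
have [N0 N00 hN0] := arc_lattice ag.
have /choice[Nz hNz] : forall i, exists N, (0 < N)%N /\
    forall M, (0 < M)%N -> (N %| M)%N -> supported (series2_of (zeta i)) (lattice M).
  by move=> i; have [N ? ?] := arc_lattice (az i); exists N.
pose N := (N0 * \prod_(i < m) Nz i)%N.
have N_gt0 : (0 < N)%N.
  by rewrite muln_gt0 N00 prodn_gt0 // => i; have [] := hNz i.
apply: (@shift_x_factorization R N) => //.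
- by apply: hN0 => //; rewrite dvdn_mulr.
- move=> [|i] q; rewrite /series2_of /order_ge1 /= ?eqxx //.
  by rewrite mulr0n add0r; exact: arc_order_ge1.
- move=> i; have [_ h] := hNz i; apply: h => //.
  by rewrite /N (bigD1 i) //= mulnCA dvdn_mulr.
Qed.

(** * Weights and initial terms *)

Section Weights.
Context {R : realType}.
Implicit Types (A B : series2 R) (s : R).

Definition weight s (i : nat) (q : rat) : R := ratr q + s * i%:R.

Lemma weightD s i j p q : weight s (i + j)%N (p + q) = weight s i p + weight s j q.
Proof. by rewrite /weight rmorphD natrD mulrDr addrACA. Qed.

Lemma weight_split s k i p q : (k <= i)%N ->
  weight s i q = weight s k p + weight s (i - k)%N (q - p).
Proof. by move=> ki; rewrite -weightD subnKC // addrC subrK. Qed.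

Lemma weight_mul_ge s x y A B :
  supported A (fun i q => x <= weight s i q) ->
  supported B (fun i q => y <= weight s i q) ->
  supported (series2_mul A B) (fun i q => x + y <= weight s i q).
Proof.
move=> hA hB i q /series2_mul_neq0[k [p [ki /hA h1 /hB h2]]].
by rewrite (weight_split _ p _ ki) lerD.
Qed.

(** The line of co-slope [s] through the exponent (i0, q0) meets the support there only and leaves
    the rest strictly above. *)
Definition initial s A i0 q0 :=
  A i0 q0 != 0 /\
  forall i q, A i q != 0 -> (i, q) = (i0, q0) \/ weight s i0 q0 < weight s i q.

(** The lowest exponent arises from a single pair of terms, since any other pair has larger total
    weight; nothing cancels it. *)
Lemma initial_mul s A B i0 q0 j0 r0 :
  initial s A i0 q0 -> initial s B j0 r0 ->
  initial s (series2_mul A B) (i0 + j0)%N (q0 + r0).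
Proof.
move=> [A0 hA] [B0 hB]; split; last first.
  move=> i q /series2_mul_neq0[k [p [ki /hA h1 /hB h2]]].
  rewrite weightD (weight_split _ p _ ki).
  case: h1 => [e1|h1]; case: h2 => [e2|h2].
  - by left; case: e1 e2 => <- <- [<- <-]; rewrite subnKC // addrC subrK.
  - by right; case: e1 h2 => -> -> h2; rewrite ltrD2l.
  - by right; case: e2 => -> ->; rewrite ltrD2r.
  - by right; rewrite ltrD.
have uniq k p : (k <= i0 + j0)%N ->
    A k p * B (i0 + j0 - k)%N (q0 + r0 - p) != 0 -> k = i0 /\ p = q0.
  move=> ki; rewrite mulf_eq0 negb_or => /andP[/hA[[-> ->] //|h1] /hB h2].
  have := weightD s i0 j0 q0 r0; rewrite (weight_split _ p _ ki) => e.
  have : weight s i0 q0 + weight s j0 r0 <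
      weight s k p + weight s (i0 + j0 - k) (q0 + r0 - p).
    apply: ltr_leD => //; case: h2 => [[-> ->] //|]; exact: ltW.
  by rewrite e ltxx.
rewrite /series2_mul (bigD1 (Ordinal (leq_addr j0 i0 : (i0 < (i0 + j0).+1)%N))) //=.
rewrite [X in _ + X]big1.
  rewrite addr0 (@fsbig_inj _ unit _ (fun=> q0)).
  - rewrite (bigD1 tt) //= [X in _ + X]big1; last by case.
    by rewrite addr0 addKn addrC addKr mulf_neq0.
  - by case; case.
  - by move=> p /uniq -[|_ ->]; [exact: leq_addr | exists tt].
move=> k kN; apply: fsbig1 => p _; apply/eqP/negPn/negP => /uniq[].
  by rewrite -ltnS ltn_ord.
by move=> ki _; move/eqP: kN; apply; apply/val_inj.
Qed.
Lemma initial_one s : initial s (@series2_one R) 0%N 0.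
Proof.
split; first by rewrite /series2_one /series2_of eqxx oner_neq0.
by move=> i q /(@supported_one R (fun i q => (i, q) = (0%N, 0))) h; left; apply: h.
Qed.

(** The order as an attained rational exponent, where [ord] is an infimum in the extended reals. *)
Definition leading (a : fracseries R) (q0 : rat) :=
  a q0 != 0 /\ forall q, a q != 0 -> q0 <= q.

Lemma ord_leading a q0 : leading a q0 -> ord a = (ratr q0 : R)%:E.
Proof.
move=> [a0 ha]; apply/eqP; rewrite eq_le; apply/andP; split.
  by apply: ereal_inf_lbound; exists q0.
by apply/ereal_infP => _ [q aq <-]; rewrite lee_fin ler_rat; exact: ha.
Qed.

Lemma linear_factor (a : fracseries R) (i : nat) (q : rat) :
  series2_add (@series2_X R) (series2_of a) i q != 0 ->
  (i, q) = (1%N, 0) \/ i = 0%N /\ a q != 0.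
Proof.
rewrite /series2_add /series2_X /series2_of.
case: i => [|[|i]] /=; rewrite ?add0r ?addr0 ?eqxx //; first by right.
by case: (q =P 0) => [->|]; [left | rewrite eqxx].
Qed.

Lemma linear_factor_weight s a q0 : 0 <= s -> leading a q0 ->
  supported (series2_add (@series2_X R) (series2_of a))
    (fun i q => Num.min s (ratr q0) <= weight s i q).
Proof.
move=> s0 [_ ha] i q /linear_factor[[-> ->]|[-> /ha h]]; rewrite /weight ge_min.
  by rewrite (rmorph0 (@ratr R)) mulr1 add0r lexx.
by rewrite mulr0 addr0 ler_rat h orbT.
Qed.

(** The candidates X, of weight [s], and Y^q0 do not tie. The exponent of X is a boolean read as 0
    or 1, so that summing over the factors counts roots. *)
Lemma linear_factor_initial s a q0 : leading a q0 -> ratr q0 != s ->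
  initial s (series2_add (@series2_X R) (series2_of a))
    (s < ratr q0)%R (if ratr q0 < s then q0 else 0).
Proof.
move=> [a0 ha] q0s; case: ltgtP q0s => // h _; split.
- by rewrite /series2_add /series2_X /series2_of /= ?eqxx addr0 oner_neq0.
- move=> i q /linear_factor[[-> ->]|[-> aq]]; first by left.
  right; rewrite /weight (rmorph0 (@ratr R)) mulr0 mulr1 addr0 add0r.
  by apply: lt_le_trans h _; rewrite ler_rat ha.
- by rewrite /series2_add /series2_X /series2_of /= mulr0n add0r.
- move=> i q /linear_factor[[-> ->]|[-> aq]].
    by right; rewrite /weight (rmorph0 (@ratr R)) mulr0 mulr1 addr0 add0r.
  have := ha _ aq; rewrite le_eqVlt => /orP[/eqP<-|]; first by left.
  by right; rewrite /weight !mulr0 !addr0 ltr_rat.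
Qed.

End Weights.

(** * Products of linear factors *)

Section Roots.
Context {R : realType} (m : nat).
Implicit Types (s : R) (a : 'I_m -> fracseries R).

Lemma prod_weight s a (q0 : 'I_m -> rat) : 0 <= s -> (forall i, leading (a i) (q0 i)) ->
  supported (\big[@series2_mul R/@series2_one R]_(i < m)
      series2_add (@series2_X R) (series2_of (a i)))
    (fun i q => \sum_(j < m) Num.min s (ratr (q0 j)) <= weight s i q).
Proof.
move=> s0 ha; elim/big_rec2: _ => [|i x A _ hA].
  by apply: supported_one; rewrite /weight (rmorph0 (@ratr R)) mulr0 addr0.
by apply: weight_mul_ge => //; apply: linear_factor_weight.
Qed.

Lemma prod_initial s a (q0 : 'I_m -> rat) : (forall i, leading (a i) (q0 i)) ->
  (forall i, ratr (q0 i) != s) ->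
  initial s (\big[@series2_mul R/@series2_one R]_(i < m)
      series2_add (@series2_X R) (series2_of (a i)))
    (\sum_(j < m) (s < ratr (q0 j))%R)%N
    (\sum_(j < m) if ratr (q0 j) < s then q0 j else 0).
Proof.
move=> ha hs; elim/big_rec3: _ => [|i k q A _ hA]; first exact: initial_one.
by apply: initial_mul => //; apply: linear_factor_initial.
Qed.

(** A term of the product free of X takes a term free of X from every factor; later this shows that
    gamma differs from each root. *)
Lemma prod_row0 (F : 'I_m -> series2 R) q :
  (\big[@series2_mul R/@series2_one R]_(i < m) F i) 0%N q != 0 ->
  forall i, exists p, F i 0%N p != 0.
Proof.
move=> h i; move: (mem_index_enum i) q h; elim: index_enum => // j r IH.
rewrite inE => ir q; rewrite big_cons => /series2_mul_neq0[k [p []]].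
rewrite leqn0 => /eqP -> h1 h2.
by move: ir => /orP[/eqP ->|/IH h]; [exists p | exact: h h2].
Qed.

End Roots.

Lemma along_shift_x (R : realType) (f : germ R) (a : fracseries R) (q : rat) :
  along f a q = shift_x f a 0%N q.
Proof.
rewrite /along /shift_x /subst_x; apply: eq_fsbigr => -[k j] _ /=.
congr (_ * _); move: (q - _); elim: k => //= k IH p; rewrite /series2_mul !big_ord1.
apply: eq_fsbigr => r _; rewrite IH; congr (_ * _).
by rewrite /series2_add /series2_X /series2_of /= mulr0n add0r.
Qed.

(** A unit stays a unit after the substitution: its constant term is the initial term at every
    positive co-slope, so multiplying by it moves no vertex. *)
Lemma subst_x_initial (R : realType) (u : germ R) (A : series2 R) (s : R) :
  0 < s -> u 0%N 0%N != 0 -> supported A order_ge1 ->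
  supported A (fun _ q => 0 <= q) -> initial s (subst_x u A) 0%N 0.
Proof.
move=> s0 u0 oA nA.
have nE k : supported (series2_exp A k) (fun _ q => 0 <= q).
  by apply: supported_exp => // *; apply: addr_ge0.
split.
  rewrite /subst_x (@fsbig_inj _ unit _ (fun=> (0%N, 0%N))).
  - rewrite (bigD1 tt) //= big1 ?addr0; last by case.
    by rewrite mulf_neq0 // /series2_one /series2_of /= oner_neq0.
  - by case; case.
  - move=> [k j] /=; rewrite mulf_eq0 negb_or => /andP[_ /(series2_exp_order oA)].
    move=> h; have : ((k + j)%:R : rat) <= 0 by rewrite natrD; lra.
    by rewrite lern0 addn_eq0 => /andP[/eqP-> /eqP->]; exists tt.
move=> i q /subst_x_neq0[k [j [_ /nE]]]; rewrite subr_ge0 => jq.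
have q0 : 0 <= q := le_trans (ler0n _ _) jq.
have [-> /=|qN0] := eqVneq q 0; last first.
  right; rewrite /weight (rmorph0 (@ratr R)) mulr0 addr0 ltr_wpDr ?mulr_ge0 ?(ltW s0) //.
  by rewrite ltr0q lt_neqAle eq_sym qN0.
case: i => [|i]; [by left | right].
by rewrite /weight mulr0 ltrD2l mulr_gt0.
Qed.

(** * Co-slopes close to a given one and avoiding a finite set *)

Section Separation.
Context {R : realFieldType}.

Lemma exists_right_gap (t : R) (r : seq R) :
  exists2 s, t < s & {in r, forall x, t < x -> s < x}.
Proof.
elim: r => [|x r [s ts hs]]; first by exists (t + 1) => //; lra.
have [tx|xt] := ltP t x.
  exists (Num.min s ((t + x) / 2)); first by rewrite lt_min ts /=; lra.
  move=> z; rewrite inE gt_min => /orP[/eqP-> _|zr tz].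
    by apply/orP; right; lra.
  by rewrite hs.
exists s => // z; rewrite inE => /orP[/eqP->|/hs //].
by rewrite ltNge xt.
Qed.

Lemma exists_left_gap (t : R) (r : seq R) :
  exists2 s, s < t & {in r, forall x, x < t -> x < s}.
Proof.
have [s ts hs] := exists_right_gap (- t) [seq - x | x <- r].
exists (- s); first by rewrite ltrNl.
by move=> x xr xt; rewrite ltrNr hs ?map_f // ltrN2.
Qed.

End Separation.

Section Conv.
Context {R : realType} (p q : convex_lmodType (R * R)%type) (l : {i01 R}).

Lemma conv_fst : ((p <| l |> q : (R * R)%type).1 : R) = l%:num * p.1 + (1 - l%:num) * q.1.
Proof. by []. Qed.

Lemma conv_snd : ((p <| l |> q : (R * R)%type).2 : R) = l%:num * p.2 + (1 - l%:num) * q.2.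
Proof. by []. Qed.

End Conv.

(** * The region cut out by the supporting lines *)

Section Polygon.
Context {R : realType} (m : nat) (c : 'I_m -> R) (c_gt0 : forall i, 0 < c i).

Definition support_fun (s : R) := \sum_(j < m) Num.min s (c j).

(** The condition on [p.1] is the vertical supporting line, which no finite [s] gives. *)
Definition polygon_region : set (R * R) :=
  [set p | 0 <= p.1 /\ forall s : R, 0 <= s -> support_fun s <= p.2 + s * p.1].

(** For [s] different from all [c j], the exponent of the initial term of the product of the X +
    Y^(c j). *)
Definition vertex (s : R) : R * R :=
  ((\sum_(j < m) (s < c j)%R)%N%:R, \sum_(j < m) if c j < s then c j else 0).

Lemma support_fun0 : support_fun 0 = 0.
Proof. by rewrite /support_fun big1 // => j _; rewrite min_l // ltW. Qed.

Lemma sum_vertex1 s t : (vertex s).1 * t = \sum_(j < m) (if s < c j then t else 0).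
Proof.
rewrite /vertex /= natr_sum mulr_suml; apply: eq_bigr => j _.
by case: ifP; rewrite ?mul1r ?mul0r.
Qed.

(* For s close to t, on either side, vertex s lies on the supporting line of
   co-slope t. *)
Lemma support_fun_vertex s t : (forall j, c j != s) ->
  (forall j, c j != t -> (s < c j) = (t < c j)) ->
  support_fun t = (vertex s).2 + t * (vertex s).1.
Proof.
move=> cs ct; rewrite [t * _]mulrC sum_vertex1 -big_split; apply: eq_bigr => j _ /=.
have := cs j; have := ct j; case: (ltgtP (c j) t) => [h|h|->] /=.
- by move=> /(_ isT) + +; case: ltgtP => // *; rewrite addr0.
- by move=> /(_ isT) + +; case: ltgtP => // *; rewrite add0r.
- by move=> _; case: ltgtP => // *; rewrite ?addr0 ?add0r ?minxx.
Qed.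

Lemma convex_polygon_region :
  convex_set (polygon_region : set (convex_lmodType (R * R)%type)).
Proof.
move=> x y l /set_mem[x1 hx] /set_mem[y1 hy]; apply/mem_set.
have l0 : 0 <= l%:inum by [].
have l1 : 0 <= 1 - l%:inum by rewrite subr_ge0.
split; first by rewrite /= addr_ge0 // mulr_ge0.
move=> s s0; have := lerD (ler_wpM2l l0 (hx s s0)) (ler_wpM2l l1 (hy s s0)).
rewrite -mulrDl addrC subrK mul1r => /le_trans; apply.
by rewrite conv_fst conv_snd; lra.
Qed.

(** Just beyond [t], [vertex] counts the [c j] > [t]; just before, those >= [t]. The two sides thus
    see the right-shifted and unshifted ends of the edge of co-slope [t]. *)
Lemma nearby_generic_right t : 0 <= t -> exists s, [/\ 0 < s, forall j, c j != s &
  forall j, (s < c j) = (t < c j)].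
Proof.
move=> t0; have [s ts hs] := exists_right_gap t [seq c j | j <- enum 'I_m].
have h j : (s < c j) = (t < c j).
  apply/idP/idP; first exact: lt_trans.
  by apply: hs; rewrite map_f ?mem_enum.
exists s; split=> //; first exact: le_lt_trans ts.
by move=> j; apply/eqP => e; have := h j; rewrite e ltxx ts.
Qed.

Lemma nearby_generic_left t : 0 < t -> exists s, [/\ 0 < s, s < t,
  forall j, c j != s & forall j, (s < c j) = (t <= c j)].
Proof.
(* Adding 0 to the list keeps [s] positive. *)
move=> t0; have [s st hs] := exists_left_gap t (0 :: [seq c j | j <- enum 'I_m]).
have h j : (s < c j) = (t <= c j).
  apply/idP/idP; last exact: lt_le_trans.
  rewrite leNgt; apply: contraL => ct; rewrite -leNgt ltW //; apply: hs => //.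
  by rewrite inE map_f ?orbT ?mem_enum.
have s0 : 0 < s by apply: hs => //; rewrite inE eqxx.
exists s; split=> // j; apply/eqP => e.
have : c j < s by apply: hs; rewrite ?e // -e inE map_f ?orbT ?mem_enum.
by rewrite e ltxx.
Qed.

Lemma region_up p u v : polygon_region p -> 0 <= u -> 0 <= v ->
  polygon_region (p.1 + u, p.2 + v).
Proof.
move=> [p0 hp] u0 v0; split=> [|s s0 /=]; first exact: addr_ge0.
have := hp s s0; have := mulr_ge0 s0 u0; lra.
Qed.

(* A point between the vertices seen on both sides of the slope t lies above
   the edge joining them, and every abscissa below m is of this kind. *)
Lemma region_in_hull (K : set (R * R)) :
  convex_set (K : set (convex_lmodType (R * R)%type)) ->
  (forall s u v, 0 < s -> (forall j, c j != s) -> 0 <= u -> 0 <= v ->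
    K ((vertex s).1 + u, (vertex s).2 + v)) ->
  polygon_region `<=` K.
Proof.
move=> convK hK [x y] [/= x0 hxy].
have y0 : 0 <= y by have := hxy 0 (lexx _); rewrite support_fun0 mul0r addr0.
(* From x = m on, the vertex (m, 0) suffices; it is the one seen at co-slopes close to 0. *)
have [mx|xm] := leP m%:R x.
  have [s [s0 cs hs]] := nearby_generic_right (lexx 0).
  have v1 : (vertex s).1 = m%:R.
    rewrite /vertex /= -[in RHS](card_ord m) -sum1_card; congr (_%:R).
    by apply: eq_bigr => j _; rewrite hs c_gt0.
  have v2 : (vertex s).2 = 0.
    by rewrite /vertex /= big1 // => j _; rewrite ltNge ltW ?hs ?c_gt0.
  have := hK s (x - m%:R) y s0 cs; rewrite v1 v2 add0r [m%:R + _]addrC subrK.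
  by apply=> //; rewrite subr_ge0.
pose above (t : R) := (\sum_(j < m) (t < c j)%R)%N.
(* The co-slope of the edge over x is the least [c j] exceeded by at most x of the others; the
   largest [c j] qualifies, being exceeded by none. *)
have [j0 abj0 minj0] : exists2 j0, (above (c j0))%:R <= x &
    forall j, (above (c j))%:R <= x -> c j0 <= c j.
  have i0 : 'I_m by case: (posnP m) => [m0|/Ordinal//]; move: xm; rewrite m0 ltNge x0.
  have [jm _ maxjm] := arg_maxP c (isT : xpredT i0).
  have abjm : (above (c jm))%:R <= x.
    by rewrite /above big1 // => j _; rewrite ltNge; have /= -> := maxjm j isT.
  by have [j ? ?] := arg_minP (P := fun j => (above (c j))%:R <= x) c abjm; exists j.
set t := c j0 in abj0 minj0.
have t0 : 0 < t by exact: c_gt0.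
have [s [s0 cs hs]] := nearby_generic_right (ltW t0).
have [r [r0 rt cr hr]] := nearby_generic_left t0.
have vs1 : (vertex s).1 <= x.
  by rewrite /= (eq_bigr (fun j => nat_of_bool (t < c j)%R)) // => j _; rewrite hs.
(* Otherwise the next smaller value among the [c j] would also qualify, against minimality; if there
   is none, all [m] of them are counted and x < m. *)
have vr1 : x < (vertex r).1.
  rewrite ltNge; apply/negP => vrx.
  have [j cjt|allt] := pickP (fun j => c j < t); last first.
    move: vrx; rewrite leNgt => /negP; apply; apply: (lt_le_trans xm).
    rewrite /= (eq_bigr (fun=> 1%N)) ?sum1_card ?card_ord //.
    by move=> j _; rewrite hr leNgt allt.
  have [i cit maxi] := arg_maxP (P := fun j => c j < t) c cjt.
  have /minj0 : (above (c i))%:R <= x.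
    rewrite /above (eq_bigr (fun j => nat_of_bool (r < c j)%R)) // => k _.
    rewrite hr; congr nat_of_bool; apply/idP/idP; last exact: lt_le_trans.
    by rewrite leNgt; apply: contraL => /maxi /=; rewrite leNgt.
  by rewrite leNgt cit.
have ps : support_fun t = (vertex s).2 + t * (vertex s).1.
  by apply: support_fun_vertex => // j _; rewrite hs.
have pr : support_fun t = (vertex r).2 + t * (vertex r).1.
  by apply: support_fun_vertex => // j ct; rewrite hr le_eqVlt eq_sym (negbTE ct).
(* [v] is the height of the point above the edge. Both ends raised by [v] lie in [K], and the point
   is their barycentre. *)
have := hxy t (ltW t0); set v := y + t * x - support_fun t => hv.
have v0 : 0 <= v by rewrite subr_ge0.
move: (hK s 0 v s0 cs (lexx 0) v0) (hK r 0 v r0 cr (lexx 0) v0).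
have := lt_le_trans vr1 (lexx _); have := le_lt_trans vs1 vr1.
rewrite -subr_gt0; move: ps pr vs1 vr1.
case: (vertex s) (vertex r) => [s1 s2] [r1 r2] /= ps pr vs1 vr1 d0 _ Ks Kr.
have l0 : 0 <= (r1 - x) / (r1 - s1) by rewrite divr_ge0 ?(ltW d0) // subr_ge0 ltW.
have l1 : (r1 - x) / (r1 - s1) <= 1.
  by rewrite ler_pdivrMr // mul1r lerD2l lerN2.
have := convK _ _ (Itv01 l0 l1) (mem_set Ks) (mem_set Kr).
have le : (r1 - x) / (r1 - s1) * (r1 - s1) = r1 - x by rewrite divfK // gt_eqF.
move/set_mem; rewrite [conv _ _ _]surjective_pairing conv_fst conv_snd /=.
move: le; move: (_ / _) => l le; congr (K (_, _)).
  have -> : l * (s1 + 0) + (1 - l) * (r1 + 0) = r1 - l * (r1 - s1) by ring.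
  by rewrite le; ring.
have e : r2 - s2 = - (t * (r1 - s1)).
  by rewrite mulrBr opprB -[t * s1](addKr s2) -ps pr; ring.
have -> : l * (s2 + v) + (1 - l) * (r2 + v) = v + r2 - l * (r2 - s2) by ring.
have -> : l * (r2 - s2) = - (t * (l * (r1 - s1))) by rewrite e; ring.
by rewrite le /v pr; ring.
Qed.

(** A sandwich: all exponents lie above the supporting lines, and the generic vertices are exponents
    of actual terms. *)
Lemma newton_regionE (G : series2 R) :
  (forall s i q, 0 <= s -> G i q != 0 -> support_fun s <= ratr q + s * i%:R) ->
  (forall s, 0 < s -> (forall j, c j != s) ->
     exists i q, G i q != 0 /\ (i%:R, ratr q) = vertex s) ->
  newton_region G = polygon_region.
Proof.
move=> Gge Gvertex; apply/seteqP; split.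
  move=> p; apply; first exact: convex_polygon_region.
  move=> _ [i [q [u [v [Giq u0 v0 ->]]]]].
  have /= := @region_up (i%:R, ratr q) u v; apply=> //.
  by split=> [|s s0]; [exact: ler0n | exact: Gge].
move=> p Wp K convK GK; apply: region_in_hull Wp => //.
move=> s u v s0 cs u0 v0; apply: GK.
have [i [q [Giq <-]]] := Gvertex s s0 cs.
by exists i, q, u, v.
Qed.

Lemma closed_halfplane (b s : R) : closed [set p : R * R | b <= p.2 + s * p.1].
Proof.
apply: (@preimage_closed _ _ (fun p : R * R => p.2 + s * p.1) [set x | b <= x]).
  move=> p _; apply: cvgD; first exact: cvg_snd.
  by apply: cvgM; [exact: cvg_cst | exact: cvg_fst].
exact: closed_ge.
Qed.

Lemma closed_polygon_region : closed polygon_region.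
Proof.
move=> p clp; split.
  have : closed [set z : R * R | 0 <= z.1].
    apply: (@preimage_closed _ _ (@fst R R) [set x | 0 <= x]).
      by move=> z _; exact: cvg_fst.
    exact: closed_ge.
  by apply; move: clp; apply: closureS => z [].
move=> s s0; apply: closed_halfplane.
by move: clp; apply: closureS => z [_ /(_ s s0)].
Qed.

Lemma closure_polygon_region : closure polygon_region = polygon_region.
Proof. by have /closure_id := closed_polygon_region. Qed.

(** Lowering a point of a supporting line, however little, leaves the region. *)
Lemma interior_polygon_region s p : 0 <= s ->
  p.2 + s * p.1 = support_fun s -> ~ interior polygon_region p.
Proof.
move=> s0 ps /nbhs_ballP[e /= e0 /(_ (p.1, p.2 - e / 2))].
case.
  split; rewrite /ball /= ?subrr ?normr0 //.
  by rewrite opprB addrC subrK ger0_norm ?divr_ge0 ?ltW //; lra.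
by move=> _ /(_ s s0) /=; lra.
Qed.

(** * The top edge *)

Section TopEdge.
Context (j0 : 'I_m) (maxc : forall j, c j <= c j0).

Let delta := c j0.
Let h := \sum_(j < m) c j.
(** The horizontal length of the top edge: each root of maximal contact contributes 1. *)
Let k := (\sum_(j < m) (c j == delta))%N%:R : R.

Let N := closure polygon_region `\` interior polygon_region.

Lemma support_fun_max s : delta <= s -> support_fun s = h.
Proof.
by move=> ds; apply: eq_bigr => j _; rewrite min_r // (le_trans (maxc j)).
Qed.

Lemma sum_top t : (\sum_(j < m) if c j == delta then t else 0) = k * t.
Proof.
rewrite /k natr_sum mulr_suml; apply: eq_bigr => j _.
by case: ifP; rewrite ?mul1r ?mul0r.
Qed.

(** Just below [delta], the supporting line passes through the right end (k, h - k delta) of the top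
    edge; this prevents the edge from going further right. *)
Lemma support_fun_near_max : exists s, [/\ 0 < s, s < delta &
  support_fun s = h - k * delta + k * s].
Proof.
have [s sd hs] := exists_left_gap delta (0 :: [seq c j | j <- enum 'I_m]).
exists s; split=> //.
  by apply: hs; rewrite ?c_gt0 // inE eqxx.
rewrite -!sum_top -sumrB -big_split; apply: eq_bigr => j _ /=.
case: eqP => [->|/eqP cd]; first by rewrite subrr add0r min_l // ltW.
rewrite subr0 addr0 min_r // ltW // hs ?inE ?map_f ?orbT ?mem_enum //.
by rewrite lt_neqAle cd maxc.
Qed.

Lemma top_segment (p : R * R) : 0 <= p.1 <= k -> p.2 + delta * p.1 = h -> N p.
Proof.
move=> /andP[p0 pk] ph; split.
  apply: subset_closure; split=> // s s0.
  have [ds|sd] := leP delta s.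
    by rewrite support_fun_max // -ph lerD2l ler_wpM2r.
  have : support_fun s <= h - k * delta + k * s.
    rewrite -!sum_top -sumrB -big_split; apply: ler_sum => j _ /=.
    case: eqP => [->|_]; first by rewrite subrr add0r ge_min lexx.
    by rewrite subr0 addr0 ge_min lexx orbT.
  (* On the edge, y + s x = h - (delta - s) x, which is least at x = k. *)
  have : 0 <= (k - p.1) * (delta - s) by rewrite mulr_ge0 // subr_ge0 // ltW.
  by lra.
apply: (@interior_polygon_region delta); first exact: ltW (c_gt0 _).
by rewrite support_fun_max.
Qed.

Lemma k_gt0 : 0 < k.
Proof.
by rewrite /k ltr0n lt0n sum_nat_eq0; apply/forallPn; exists j0; rewrite eqxx.
Qed.

Definition max_edge : edge R := ((0, h), (k, h - k * delta)).

Lemma coslope_max_edge : coslope max_edge = delta.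
Proof.
by rewrite /coslope /horizontal_length /= subr0 opprB addrC subrK mulrAC mulfV
  ?mul1r // gt_eqF ?k_gt0.
Qed.

Lemma compact_edge_max_edge : compact_edge N max_edge.
Proof.
split; first by rewrite /horizontal_length /= subr0 k_gt0.
  move=> z [+ _]; rewrite closure_polygon_region => -[_ /(_ delta (ltW (c_gt0 _)))].
  by rewrite /level coslope_max_edge support_fun_max //= mulr0 addr0.
rewrite /level coslope_max_edge /= mulr0 addr0; apply/seteqP; split.
  move=> [x y] [[+ _]]; rewrite closure_polygon_region => -[/= x0 hxy] yx.
  have [s [s0 sd ps]] := support_fun_near_max.
  have := hxy s (ltW s0); rewrite ps => hs.
  have xk : x <= k.
    rewrite -(ler_pM2r (x := delta - s)) ?subr_gt0 //; lra.
  have l0 : 0 <= (k - x) / k by rewrite divr_ge0 ?(ltW k_gt0) // subr_ge0.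
  have l1 : (k - x) / k <= 1 by rewrite ler_pdivrMr ?k_gt0 // mul1r; lra.
  have le : (k - x) / k * k = k - x by rewrite divfK // gt_eqF ?k_gt0.
  exists (Itv01 l0 l1) => //; rewrite [LHS]surjective_pairing conv_fst conv_snd /=.
  move: le; move: (_ / _) => l le; congr (_, _).
    have -> : l * 0 + (1 - l) * k = k - l * k by ring.
    by rewrite le; ring.
  have -> : l * h + (1 - l) * (h - k * delta) = h - k * delta + l * k * delta by ring.
  by rewrite le -yx; ring.
move=> _ [l _ <-].
have l1 : 0 <= 1 - l%:num by rewrite subr_ge0.
have l0 : 0 <= l%:num by [].
split; last by rewrite /mkset conv_fst conv_snd /=; ring.
apply: top_segment; rewrite conv_fst ?conv_snd /=; last by ring.
by rewrite mulr0 add0r mulr_ge0 ?(ltW k_gt0) //= ler_piMl ?(ltW k_gt0) // gerBl.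
Qed.

(** The right end of [e] lies above the line of co-slope [delta], which bounds the co-slope of [e]
    by [delta]; the right end of [max_edge] lies above the line of [e], which gives the converse. *)
Lemma coslope_max_edge_unique (e : edge R) :
  compact_edge N e -> e.1 = (0, h) -> coslope e = delta.
Proof.
move=> [e0 eN eseg] e1.
have N2 : (N `&` [set z | level e z = level e e.1]) e.2.
  by rewrite eseg; exists 0%:i01 => //; rewrite conv0.
case: N2 => -[+ _]; rewrite closure_polygon_region => -[_ /(_ delta (ltW (c_gt0 _)))].
rewrite support_fun_max // => h2 /= lev2.
have Nk : N (k, h - k * delta).
  by apply: top_segment => /=; [rewrite (ltW k_gt0) lexx | ring].
have := eN _ Nk; move: lev2 e0; rewrite /level e1 /horizontal_length e1 /= mulr0 addr0 subr0.
move=> lev2 e0 hk; apply/eqP; rewrite eq_le; apply/andP; split.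
  by rewrite -(ler_pM2r e0); move: h2 lev2; lra.
by rewrite -(ler_pM2l k_gt0); move: hk; lra.
Qed.

End TopEdge.

End Polygon.

(** * The Newton polygon of a polar arc *)

(** The exponents of the difference are natural multiples of one fraction, so there is a least
    one. *)
Lemma exists_leading (R : realType) (a b : fracseries R) :
  Defs.arc a -> Defs.arc b -> (exists q, a q - b q != 0) ->
  exists2 q0, leading (fun q => a q - b q) q0 & 1 <= q0.
Proof.
move=> aa ab [q1 abq1].
have [M M0 la] := arc_lattice aa; have [N N0 lb] := arc_lattice ab.
have MN0 : (0 < M * N)%N by rewrite muln_gt0 M0.
have lab q : a q - b q != 0 -> lattice (M * N) 0%N q.
  have [->|aq _] := eqVneq (a q) 0.
    by rewrite sub0r oppr_eq0; apply: (lb _ MN0 (dvdn_mull _ (dvdnn N)) 0%N).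
  exact: (la _ MN0 (dvdn_mulr _ (dvdnn M)) 0%N q aq).
pose P k := a (k%:R / (M * N)%:R) - b (k%:R / (M * N)%:R) != 0.
have exP : exists k, P k by have [k e] := lab _ abq1; exists k; rewrite /P -e.
have [k Pk mink] := ex_minnP exP; exists (k%:R / (M * N)%:R).
  split=> // q abq; have [l e] := lab _ abq; rewrite e.
  rewrite ler_pM2r ?invr_gt0 ?ltr0n // ler_nat mink //.
  by rewrite /P -e.
move: Pk; rewrite /P; set q := _ / _.
have [->|aq _] := eqVneq (a q) 0; last exact: arc_order_ge1 aa aq.
by rewrite sub0r oppr_eq0; exact: arc_order_ge1.
Qed.

Lemma newton_region_arc (R : realType) (f : germ R) m (zeta : 'I_m -> fracseries R)
    (gamma : fracseries R) :
  puiseux_roots f zeta -> polar_arc f gamma ->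
  exists c : 'I_m -> R, [/\ forall i, 0 < c i,
    forall i, contact gamma (zeta i) = (c i)%:E,
    newton_region (shift_x f gamma) = polygon_region c &
    ord (along f gamma) = (\sum_i c i)%:E].
Proof.
move=> rf [ag _ [qf fq]].
have [u [u0 fE]] := puiseux_roots_factorization rf ag; have [az _] := rf.
have /choice[q0 lead] : forall i, exists q : rat,
    leading (fun q => gamma q - zeta i q) q /\ 1 <= q.
  move=> i; suff [q ? ?] : exists2 q0, leading (fun q => gamma q - zeta i q) q0
      & 1 <= q0 by exists q.
  apply: exists_leading => //.
  (* Were gamma equal to a root, that factor would have no term free of X and f would vanish along
     gamma. *)
  move: fq; rewrite along_shift_x fE => /series2_mul_neq0[k [p []]].
  rewrite leqn0 => /eqP-> _ /prod_row0/(_ i)[r].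
  by rewrite /series2_add /series2_X /series2_of /= mulr0n add0r; exists r.
have lead0 i := (lead i).1.
pose c i : R := ratr (q0 i).
have c0 i : 0 < c i by rewrite ltr0q (lt_le_trans ltr01) // (lead i).2.
have oA : supported (series2_add (@series2_X R) (series2_of gamma)) order_ge1.
  move=> i q /linear_factor[[-> ->]|[-> aq]]; rewrite /order_ge1 ?addr0 //.
  by rewrite add0r; exact: arc_order_ge1 ag aq.
have nA : supported (series2_add (@series2_X R) (series2_of gamma))
    (fun _ q => 0 <= q).
  move=> i q /linear_factor[[_ ->]|[_ aq]] //.
  exact: le_trans ler01 (arc_order_ge1 ag aq).
have initial_f s : 0 < s -> (forall i, c i != s) ->
    initial s (shift_x f gamma) (\sum_j (s < c j)%R)%N
      (\sum_j if c j < s then q0 j else 0).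
  move=> s0 cs; rewrite fE.
  have := initial_mul (subst_x_initial s0 u0 oA nA) (prod_initial lead0 cs).
  by rewrite add0n add0r.
have vertexE s : ((\sum_j (s < c j)%R)%N%:R,
    ratr (\sum_j if c j < s then q0 j else 0)) = vertex c s.
  congr (_, _); rewrite rmorph_sum; apply: eq_bigr => j _ /=.
  by case: ifP => // _; rewrite rmorph0.
have weight_f s : 0 <= s -> supported (shift_x f gamma)
    (fun i q => support_fun c s <= weight s i q).
  move=> s0; rewrite fE -[support_fun c s]add0r; apply: weight_mul_ge; last first.
    exact: prod_weight.
  move=> i q /subst_x_neq0[k [j [_ h]]].
  have nE : supported (series2_exp (series2_add (@series2_X R) (series2_of gamma)) k)
      (fun _ q => 0 <= q) by apply: supported_exp => // *; apply: addr_ge0.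
  have := nE _ _ h.
  rewrite subr_ge0 => jq; rewrite /weight addr_ge0 //; last exact: mulr_ge0.
  by rewrite ler0q (le_trans _ jq).
exists c; split=> //.
- by move=> i; rewrite /contact (ord_leading (lead0 i)).
- apply: newton_regionE => // [s i q s0 /(weight_f s s0) //|s s0 cs].
  by have [fv _] := initial_f s s0 cs; eexists; eexists; split; [exact: fv|].
(* A co-slope above every [c i], all being positive: the initial term is then free of X, hence is
   that of f(gamma(y), y). *)
- pose s := 1 + \sum_i c i.
  have cs i : c i < s.
    rewrite /s (bigD1 i) //= addrCA ltrDl ltr_wpDr // sumr_ge0 // => j _.
    exact: ltW.
  have s0 : 0 < s by rewrite ltr_wpDr // sumr_ge0 // => j _; exact: ltW.
  have [fv minv] := initial_f s s0 (fun i => negbT (lt_eqF (cs i))).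
  have v0 : (\sum_j (s < c j)%R)%N = 0%N.
    by rewrite big1 // => j _; rewrite ltNge ltW.
  rewrite v0 in fv minv.
  have -> : \sum_i c i = ratr (\sum_j if c j < s then q0 j else 0).
    by rewrite rmorph_sum; apply: eq_bigr => j _; rewrite cs.
  apply: ord_leading; split; first by rewrite along_shift_x.
  move=> q; rewrite along_shift_x => /minv[[->] //|].
  by rewrite /weight !mulr0 !addr0 ltr_rat => /ltW.
Qed.

(** * Comparison of matched polars *)

Theorem lemma3p1 (R : realType)
  (f g : germ R) (m n : nat)
  (hf : holomorphic_germ f) (hf0 : f 0%N 0%N = 0%R) (hfm : mini_regular f m)
  (hg : holomorphic_germ g) (hg0 : g 0%N 0%N = 0%R) (hgn : mini_regular g n)
  (zeta : 'I_m -> fracseries R) (hzeta : puiseux_roots f zeta)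
  (xi : 'I_n -> fracseries R) (hxi : puiseux_roots g xi)
  (phi : (R[i]^o * R[i]^o)%type -> (R[i]^o * R[i]^o)%type)
  (hphi : topological_equivalence f g phi)
  (sigma : 'I_m -> 'I_n) (hsigma : kuo_lu_isomorphism zeta xi sigma)
  (gamma gamma' : fracseries R)
  (hgamma : polar_arc f gamma) (hgamma' : polar_arc g gamma')
  (hmatch : matched_polars zeta xi sigma gamma gamma') :
  exists delta_top : R,
    [/\ unique (top_coslope f gamma) delta_top,
        unique (top_coslope g gamma') delta_top
      & edges_below f gamma delta_top = edges_below g gamma' delta_top].
Proof.
have [c [c0 cE regf ordf]] := newton_region_arc hzeta hgamma.
have [d [d0 dE regg ordg]] := newton_region_arc hxi hgamma'.
have dc i : d (sigma i) = c i.
  by have := hmatch i; rewrite cE dE => -[].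
have [sigma_bij _] := hsigma.
(* The contacts enter the region only through a symmetric sum, so relabelling the roots by [sigma]
   does not change it. *)
have supp_eq : support_fun d = support_fun c.
  apply/funext => s; rewrite /support_fun (reindex sigma) /=; last exact: onW_bij.
  by apply: eq_bigr => i _; rewrite dc.
have sum_eq : \sum_i d i = \sum_i c i.
  rewrite (reindex sigma) /=; last exact: onW_bij.
  by apply: eq_bigr => i _; rewrite dc.
have polyE : arc_polygon g gamma' = arc_polygon f gamma.
  rewrite /arc_polygon /newton_polygon regf regg.
  by rewrite /polygon_region supp_eq.
(* As f vanishes at the origin its multiplicity is positive, so there is a root of maximal
   contact. *)
have m_gt0 : (0 < m)%N.
  have [[_ [i [j [ij fij]]]] _] := hfm; rewrite -ij lt0n addn_eq0.
  by apply: contraNN fij => /andP[/eqP-> /eqP->]; rewrite hf0.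
have [j0 _ maxj0] := arg_maxP c (isT : xpredT (Ordinal m_gt0)).
have maxc j : c j <= c j0 by exact: maxj0.
have uniq_f : unique (top_coslope f gamma) (c j0).
  split.
    exists (max_edge c j0); split; last exact: coslope_max_edge.
    split=> //.
    by rewrite /arc_polygon /newton_polygon regf; exact: compact_edge_max_edge.
  move=> _ [e [[ce e1 e2] <-]]; apply/esym.
  move: ce e2; rewrite /arc_polygon /newton_polygon regf ordf => ce [e2].
  by apply: coslope_max_edge_unique ce _ => //; rewrite [LHS]surjective_pairing e1 e2.
exists (c j0); split=> //; last by rewrite /edges_below polyE.
have -> // : top_coslope g gamma' = top_coslope f gamma.
by rewrite /top_coslope /top_edge polyE ordf ordg sum_eq.
Qed.
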